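(* Let $r<r'$ be any two positive reals. Then $C_{r'}(0)\setminus C_r(t)\neq\emptyset$ for every function $t=o(n)$. That is, there is a decision problem with restricted inputs that has a zero-round randomized $(p,q)$-decider for some constants $p,q\in(0,1]$ with $p^{1+1/r'}+q>1$, but has no randomized $(p,q)$-decider running in at most $t$ rounds for any constants $p,q\in(0,1]$ with $p^{1+1/r}+q>1$.
   Context: Model ($\mathcal{LOCAL}$). The network is a connected graph $G$ on $n$ nodes. An identity assignment $\mathrm{Id}$ gives distinct integers to the nodes. All nodes start simultaneously, run the same algorithm, and proceed in fault-free synchronous rounds; in each round every node sends messages of unlimited size to its neighbors, receives the messages of its neighbors, and performs arbitrary local computations. Initially a node knows only its identity and its local input (in particular not $n$). Each node eventually terminates and outputs ''yes'' or ''no''; the number of rounds may vary among nodes. In $t$ rounds, the output of a node depends only on the radius-$t$ neighborhood around it (structure, identities, inputs, and random bits). In a randomized algorithm, each node may in addition generate private, mutually independent random bits at any round. Languages and decision problems with restricted inputs. Let $\Sigma$ be a finite or infinite set of symbols. An instance is a pair $(G,\mathbf{x})$ where $G$ is a connected $n$-node graph and $\mathbf{x}\in\Sigma^n$ assigns to each node $v$ a local input $\mathbf{x}(v)\in\Sigma$; instances are regarded as input-labelled graphs, up to isomorphism. A distributed language $\mathcal{L}$ is a decidable collection of instances. A decision problem with restricted inputs consists of a language $\mathcal{L}$ together with a set $\mathcal{I}\subseteq\bigcup_n\Sigma^n$ of allowed input vectors (a promise); an instance $(G,\mathbf{x})$ is admissible if $\mathbf{x}\in\mathcal{I}$ (admissibility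 being likewise invariant under isomorphism). Taking $\mathcal{I}$ to be everything gives an ordinary language. Deciders. For constants $p,q\in(0,1]$, a randomized algorithm is a $(p,q)$-decider for the problem $(\mathcal{L},\mathcal{I})$ if for every admissible instance $(G,\mathbf{x})$ and every identity assignment $\mathrm{Id}$, every node eventually terminates with output ''yes'' or ''no'', and: if $(G,\mathbf{x})\in\mathcal{L}$ then $\Pr[\text{all nodes output ''yes''}]\ge p$; if $(G,\mathbf{x})\notin\mathcal{L}$ then $\Pr[\text{at least one node outputs ''no''}]\ge q$. Its running time on $(G,\mathbf{x},\mathrm{Id})$ is the maximum, over all nodes and all coin tosses, of the number of rounds until termination. For a positive real $r$ and a function $t$ of triplets $(G,\mathbf{x},\mathrm{Id})$, $C_r(t)$ is the class of all decision problems with restricted inputs that, for some constants $p,q\in(0,1]$ with $p^{1+1/r}+q>1$, have a $(p,q)$-decider whose running time is at most $t(G,\mathbf{x},\mathrm{Id})$ on every admissible instance and every identity assignment. Here $t=o(n)$ means that $t(G,\mathbf{x},\mathrm{Id})/n\to0$ uniformly over triplets on $n$-node graphs as $n\to\infty$. *)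

(* Defs.v *)
From HB Require Import structures.
From mathcomp Require Import all_boot all_order all_algebra.
From mathcomp Require Import boolp classical_sets reals topology normedtype.
From mathcomp Require Import sequences exp.

Set Implicit Arguments.
Unset Strict Implicit.
Unset Printing Implicit Defensive.

Import Order.TTheory GRing.Theory Num.Theory.
Import numFieldNormedType.Exports.

Local Open Scope classical_set_scope.
Local Open Scope ring_scope.

(** * Instances *)

Record graph := Graph {
  nodes : nat;
  adj : rel 'I_nodes;
  nodes_gt0 : (0 < nodes)%N;
  adj_sym : symmetric adj;
  adj_irr : irreflexive adj;
  adj_conn : forall u v, connect adj u v }.

(* The alphabet is a countType: decidability of a language only makes sense
   once the symbols have finite codes, given here by pickle. *)
Record instance (Sigma : countType) := Instance {
  net :> graph;
  input : (nodes net).-tuple Sigma }.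

Definition isomorphic (Sigma : countType) (X Y : instance Sigma) : Prop :=
  exists f : 'I_(nodes X) -> 'I_(nodes Y),
    [/\ bijective f,
        forall u v, adj (f u) (f v) = adj u v &
        forall v, tnth (input Y) (f v) = tnth (input X) v].

Record triplet (Sigma : countType) := Triplet {
  inst :> instance Sigma;
  ident : 'I_(nodes inst) -> int;
  ident_inj : injective ident }.

(** * Decidability: deterministic one-tape Turing machines *)

(* Tape symbols are [option (A + work)]; [None] is the blank. A transition
   either halts with a verdict, or moves to a new state, writes a symbol and
   moves the head to the right ([true]) or to the left ([false]). *)
Record machine (A : finType) := Machine {
  mstate : finType;
  work : finType;
  mstart : mstate;
  delta : mstate -> option (A + work) ->
          bool + mstate * option (A + work) * bool }.

(* [mrun M k q l s] runs [k] transitions from state [q]; [l] is the tape to the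
   left of the head, nearest cell first, and [s] is the tape from the scanned
   cell on; both are continued by blanks. *)
Fixpoint mrun (A : finType) (M : machine A) (k : nat) (q : mstate M)
    (l s : seq (option (A + work M))) : option bool :=
  if k is k'.+1 then
    match delta q (head None s) with
    | inl b => Some b
    | inr (q', c, true) => mrun k' q' (c :: l) (behead s)
    | inr (q', c, false) =>
        mrun k' q' (behead l) (head None l :: c :: behead s)
    end
  else None.

Definition mhalts (A : finType) (M : machine A) (w : seq A) (b : bool) : Prop :=
  exists k, mrun k (mstart M) [::] [seq Some (inl a) | a <- w] = Some b.

(* The inputs in unary, each closed by a 0, then the separator [None], then the
   rows of the adjacency matrix. *)
Definition encode (Sigma : countType) (X : instance Sigma) : seq (option bool) :=
  flatten [seq rcons (nseq (pickle a) (Some true)) (Some false) | a <- input X]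
  ++ None :: [seq Some (adj u v) | u <- enum 'I_(nodes X), v <- enum 'I_(nodes X)].

Definition decidable_language (Sigma : countType)
    (L : set (instance Sigma)) : Prop :=
  exists M : machine (option bool),
    forall X, exists2 b, mhalts M (encode X) b & b <-> L X.

(* [seq Sigma] is the union of the Sigma^n. *)
Record problem (Sigma : countType) := Problem {
  lang : set (instance Sigma);
  allowed : set (seq Sigma);
  lang_decidable : decidable_language lang;
  lang_iso : forall X Y, isomorphic X Y -> lang X -> lang Y;
  allowed_iso : forall X Y : instance Sigma,
    isomorphic X Y -> allowed (input X) -> allowed (input Y) }.

Definition admissible (Sigma : countType) (P : problem Sigma)
    (X : instance Sigma) : Prop := allowed P (input X).

(** * Randomized algorithms in the LOCAL model *)

(* A local computation in state [s] starts by tossing [tosses s] coins (an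
   always terminating computation tosses a bounded number of coins, so nothing
   is lost by tossing them in advance) and is otherwise an arbitrary function.
   Messages being unbounded, a node may as well send the same message to all its
   neighbors; a node receives them labelled by the identities of the senders. *)
Record algorithm (Sigma : Type) := Algorithm {
  state : Type;
  msg : Type;
  wake : int -> Sigma -> state;
  tosses : state -> nat;
  compute : state -> seq bool -> state;
  send : state -> msg;
  receive : state -> (int -> option msg) -> state;
  output : state -> option bool }.

(* [w k v j] is the [j]-th coin of node [v] in round [k]; round 0 is the
   computation that precedes any communication. *)
Definition coins (n : nat) := nat -> 'I_n -> nat -> bool.

Section Run.
Variables (Sigma : countType) (A : algorithm Sigma) (T : triplet Sigma).
Variable w : coins (nodes T).

Definition local_step (k : nat) (v : 'I_(nodes T)) (s : state A) : state A :=
  compute s [seq w k v j | j <- iota 0 (tosses s)].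

Definition inbox (c : 'I_(nodes T) -> state A) (v : 'I_(nodes T)) :
    int -> option (msg A) :=
  fun i => omap (fun u => send (c u)) [pick u | adj v u && (ident u == i)].

Fixpoint config (k : nat) : 'I_(nodes T) -> state A :=
  if k is k'.+1 then
    fun v => local_step k v (receive (config k' v) (inbox (config k') v))
  else fun v => local_step 0 v (wake A (ident v) (tnth (input T) v)).

(* Only the first output of a node counts. A node that has terminated may still
   relay messages, so that what is within reach in [k] rounds is the whole
   radius-[k] neighborhood whatever the termination times of the other nodes. *)
Definition terminates_at (v : 'I_(nodes T)) (k : nat) (b : bool) : Prop :=
  output (config k v) = Some b /\
  forall j, (j < k)%N -> output (config j v) = None.

Definition outputs (v : 'I_(nodes T)) (b : bool) : Prop :=
  exists k, terminates_at v k b.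

End Run.

Arguments terminates_at {Sigma} A T w v k b.
Arguments outputs {Sigma} A T w v b.

(** * Probabilities *)

Definition extend_coins (n N : nat) (w : {ffun 'I_N * 'I_n * 'I_N -> bool}) :
    coins n :=
  fun k v j => if (insub k, insub j) is (Some k', Some j')
               then w (k', v, j') else false.

Definition frequency (R : realType) (n : nat) (E : set (coins n)) (N : nat) : R :=
  #|[set w : {ffun 'I_N * 'I_n * 'I_N -> bool} | `[< E (extend_coins w) >]]%SET|%:R
  / #|{ffun 'I_N * 'I_n * 'I_N -> bool}|%:R.

(* Probability of an event for independent fair coins. If all nodes terminate
   whatever the coins, then by compactness the outputs depend on finitely many
   coins only; for such an event [frequency E N] is, for all large [N], the
   probability of [E] under the uniform measure on the coins it depends on. *)
Definition Pr (R : realType) (n : nat) (E : set (coins n)) : R :=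
  lim (frequency R E @ \oo).

(** * Deciders and the classes C_r(t) *)

Section Deciders.
Variables (R : realType) (Sigma : countType).
Implicit Types (A : algorithm Sigma) (P : problem Sigma) (T : triplet Sigma).

Definition all_yes A T : set (coins (nodes T)) :=
  [set w | forall v, outputs A T w v true].

Definition some_no A T : set (coins (nodes T)) :=
  [set w | exists v, outputs A T w v false].

Arguments all_yes A T : clear implicits.
Arguments some_no A T : clear implicits.

Definition decider (p q : R) A P : Prop :=
  forall T, admissible P T ->
    [/\ forall w v, exists b, outputs A T w v b,
        lang P T -> p <= Pr R (all_yes A T) &
        ~ lang P T -> q <= Pr R (some_no A T)].

Definition runs_within (t : triplet Sigma -> R) A P : Prop :=
  forall T, admissible P T ->
    forall w v k b, terminates_at A T w v k b -> k%:R <= t T.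

Definition class_C (r : R) (t : triplet Sigma -> R) : set (problem Sigma) :=
  [set P | exists p q : R,
    [/\ 0 < p <= 1, 0 < q <= 1, p `^ (1 + r^-1) + q > 1 &
        exists2 A, decider p q A P & runs_within t A P]].

Definition little_o_nodes (t : triplet Sigma -> R) : Prop :=
  forall e : R, 0 < e ->
    \forall n \near \oo, forall T, nodes T = n -> `|t T / n%:R| <= e.

End Deciders.

(* Main.v *)
(* A node holding the symbol a is selected. For naturals A < B with
   1 + 1/r' < B/A <= 1 + 1/r, the problem is to accept at most A selected nodes,
   under the promise that there are at most A or at least B of them. In zero
   rounds, every selected node tosses one coin and says no on tails: k selected
   nodes all say yes with probability 2^-k, so that p = 2^-A and q = 1 - 2^-B.

   Conversely let n nodes form a path with B far apart marks. Between
   consecutive marks there are m far apart candidate gaps, which see no mark.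
   With no node selected, the m unions of gaps of the same rank say yes
   independently, and all of them do with probability at least p; for m large
   some union of gaps says no with probability at most d. This union cuts the
   path into B segments, one around each mark, whose outputs are independent. If
   y j is the probability that segment j says yes when its mark is selected, the
   product of the y j over any A segments is at least p, hence the product over
   all B segments is at least p^(B/A) >= p^(1+1/r). With all B marks selected,
   everybody then says yes with probability at least p^(1+1/r) - d, which
   exceeds 1 - q for d small. *)

Require Import Defs.
From mathcomp Require Import all_boot all_order all_algebra.
From mathcomp Require Import boolp classical_sets reals topology normedtype.
From mathcomp Require Import sequences exp.
From mathcomp Require Import zify lra.

Set Implicit Arguments.
Unset Strict Implicit.
Unset Printing Implicit Defensive.

Import Order.TTheory GRing.Theory Num.Theory.
Import numFieldNormedType.Exports.

Local Open Scope classical_set_scope.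
Local Open Scope ring_scope.

(** * Uniform probability on finite products of coins *)

Definition prob (R : realType) (T : finType) (E : pred T) : R :=
  #|E|%:R / #|T|%:R.

Section Prob.
Variables (R : realType) (T : finType).
Implicit Types E F : pred T.

Lemma eq_prob E F : E =1 F -> prob R E = prob R F.
Proof. by move=> EF; rewrite /prob (eq_card EF). Qed.

Lemma prob_ge0 E : 0 <= prob R E.
Proof. by rewrite divr_ge0. Qed.

Lemma prob_le E F : (forall u, E u -> F u) -> prob R E <= prob R F.
Proof.
move=> EF; rewrite /prob ler_wpM2r ?invr_ge0 // ler_nat.
by apply: subset_leq_card; apply/fintype.subsetP => u; apply: EF.
Qed.

Hypothesis T_gt0 : (0 < #|T|)%N.

Lemma probC E : prob R (predC E) = 1 - prob R E.
Proof.
have T0 : #|T|%:R != 0 :> R by rewrite pnatr_eq0 -lt0n.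
apply/eqP; rewrite eq_sym subr_eq -mulrDl -natrD addnC cardC divff //.
Qed.

Lemma prob_le_predI E F : prob R E <= prob R (predI E F) + (1 - prob R F).
Proof.
rewrite -probC /prob -mulrDl -natrD ler_wpM2r ?invr_ge0 // ler_nat.
rewrite -(cardID F E) leq_add2l.
by apply: subset_leq_card; apply/fintype.subsetP => u; rewrite !inE => /andP[].
Qed.

End Prob.

Section Coins.
Variables (R : realType) (J : finType).
Local Notation Omega := {ffun J -> bool}.

Lemma card_coins_gt0 : (0 < #|{: Omega}|)%N.
Proof. by apply/card_gt0P; exists [ffun=> true]. Qed.

Definition depends_on (E : pred Omega) (S : pred J) : Prop :=
  forall u u' : Omega, {in S, u =1 u'} -> E u = E u'.

Definition splice (S : pred J) (u v : Omega) : Omega :=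
  [ffun z => if S z then u z else v z].

(* Exchanging the coins outside S between two independent copies (u, v) is an
   involution that turns the event E u /\ F u into E u /\ F v. *)
Lemma prob_independent2 (E F : pred Omega) (S : pred J) :
  depends_on E S -> depends_on F (predC S) ->
  prob R (predI E F) = prob R E * prob R F.
Proof.
move=> ES FS.
have Omega0 : #|{: Omega}|%:R != 0 :> R by rewrite pnatr_eq0 -lt0n card_coins_gt0.
pose swap (z : Omega * Omega) := (splice S z.1 z.2, splice S z.2 z.1).
have swapK : involutive swap.
  by case=> u v; congr (_, _); apply/ffunP=> z; rewrite !ffunE; case: (S z).
suff card_swap : (#|predI E F| * #|{: Omega}| = #|E| * #|F|)%N.
  rewrite /prob mulf_div -!natrM -card_swap !natrM invfM.
  by rewrite mulrA mulfK.
rewrite -!cardX -!sum1_card (reindex_inj (inv_inj swapK)) /=.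
apply: eq_bigl => -[u v]; rewrite !inE /= andbT; congr (_ && _).
  by apply: ES => z; rewrite unfold_in !ffunE => ->.
by apply: FS => z; rewrite unfold_in /= !ffunE => /negPf ->.
Qed.

Lemma prob_independent (I : eqType) (s : seq I) (E : I -> pred Omega)
    (S : I -> pred J) :
  uniq s -> (forall i, depends_on (E i) (S i)) ->
  (forall i j z, S i z -> S j z -> i = j) ->
  prob R (fun u => all (E^~ u) s) = \prod_(i <- s) prob R (E i).
Proof.
move=> + ES disjS; elim: s => [_|i s IHs /= /andP[i_s s_uniq]].
  rewrite big_nil /prob /= divff // pnatr_eq0 -lt0n card_coins_gt0 //.
rewrite big_cons -IHs //; apply: (prob_independent2 (ES i)) => u u' eq_u.
apply: eq_in_all => j j_s; apply: ES => z Sjz; apply: eq_u.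
by apply: contra i_s => Siz; rewrite (disjS i j z).
Qed.

Lemma prob_coin (z : J) : prob R (fun u : Omega => u z) = 2^-1.
Proof.
pose flip (u : Omega) : Omega := [ffun x => (x == z) (+) u x].
have flipK : involutive flip.
  by move=> u; apply/ffunP=> x; rewrite !ffunE addKb.
have : prob R (fun u : Omega => u z) = prob R (predC (fun u : Omega => u z)).
  rewrite /prob -!sum1_card (reindex_inj (inv_inj flipK)); congr (_%:R / _).
  by apply: eq_bigl => u; rewrite !unfold_in /= ffunE eqxx.
rewrite (probC _ card_coins_gt0); lra.
Qed.

Lemma prob_all_coins (I : eqType) (s : seq I) (f : I -> J) :
  injective f -> uniq s ->
  prob R (fun u : Omega => all (fun i => u (f i)) s) = 2^-1 ^+ size s.
Proof.
move=> f_inj s_uniq.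
rewrite (@prob_independent _ s (fun i u => u (f i)) (fun i => pred1 (f i))) //.
- by under eq_bigr do rewrite prob_coin; rewrite big_const_seq count_predT iter_mulr_1.
- by move=> i u u' ->; rewrite ?inE.
- by move=> i j z /= /eqP -> /eqP /f_inj.
Qed.

(** Exchanging the coins [u] with those that [f] picks from [v] is an involution on pairs [(u, v)];
    it carries the event read off [v] to the event [E u]. *)
Lemma prob_marginal (I : finType) (f : I -> J) (E : pred {ffun I -> bool}) :
  injective f -> prob R (fun u : Omega => E [ffun i => u (f i)]) = prob R E.
Proof.
move=> f_inj.
pose put (u : {ffun I -> bool}) (v : Omega) : Omega :=
  [ffun z => if [pick i | f i == z] is Some i then u i else v z].
pose swap (z : {ffun I -> bool} * Omega) :=
  ([ffun i => z.2 (f i)] : {ffun I -> bool}, put z.1 z.2).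
have putE u v i : put u v (f i) = u i.
  rewrite ffunE; case: pickP => [j /eqP /f_inj -> //|/(_ i)].
  by rewrite eqxx.
have swapK : involutive swap.
  case=> u v; congr (_, _); apply/ffunP=> z; first by rewrite ffunE putE.
  rewrite /= ffunE; case: pickP => [i /eqP <-|no_i]; first by rewrite ffunE.
  by rewrite ffunE; case: pickP => // i; rewrite no_i.
have card0 (K : finType) : #|{: {ffun K -> bool}}|%:R != 0 :> R.
  by rewrite pnatr_eq0 -lt0n; apply/card_gt0P; exists [ffun=> true].
apply/eqP; rewrite /prob eqr_div // -!natrM; apply/eqP; congr _%:R.
rewrite mulnC -!cardX -!sum1_card (reindex_inj (inv_inj swapK)) /=.
apply: eq_bigl => -[u v]; rewrite !inE /= !unfold_in /= andbT.
by congr (E _); apply/ffunP=> i; rewrite ffunE putE.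
Qed.

End Coins.

(** * Events that depend on finitely many coins *)

Definition agree_below (n N : nat) (w w' : coins n) : Prop :=
  forall k v j, (k < N)%N -> (j < N)%N -> w k v j = w' k v j.

Definition determined_below (n N : nat) (E : set (coins n)) : Prop :=
  forall w w', agree_below N w w' -> E w -> E w'.

Lemma agree_below_sym (n N : nat) (w w' : coins n) :
  agree_below N w w' -> agree_below N w' w.
Proof. by move=> ww' k v j kN jN; rewrite ww'. Qed.

Lemma agree_belowW (n N N' : nat) (w w' : coins n) :
  (N <= N')%N -> agree_below N' w w' -> agree_below N w w'.
Proof. by move=> NN' ww' k v j kN jN; apply: ww'; apply: leq_trans NN'. Qed.

Lemma extend_coinsE (n N : nat) (w : {ffun 'I_N * 'I_n * 'I_N -> bool})
    (k j : 'I_N) v : extend_coins w k v j = w (k, v, j).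
Proof. by rewrite /extend_coins !valK. Qed.

Section Determined.
Variables (R : realType) (n : nat).
Implicit Types E : set (coins n).

Definition coin_event E N : pred {ffun 'I_N * 'I_n * 'I_N -> bool} :=
  fun w => `[< E (extend_coins w) >].

Arguments coin_event E N w : clear implicits.

Lemma frequencyE E N : frequency R E N = prob R (coin_event E N).
Proof. by rewrite /frequency /prob cardsE. Qed.

(** The coins below [N] embed into those below [N'], and the uniform measure on the larger box
    projects to the uniform measure on the smaller one. *)
Lemma frequency_determined E N N' :
  determined_below N E -> (N <= N')%N -> frequency R E N' = frequency R E N.
Proof.
move=> EN NN'; rewrite !frequencyE.
pose f (z : 'I_N * 'I_n * 'I_N) :=
  (widen_ord NN' z.1.1, z.1.2, widen_ord NN' z.2).
have f_inj : injective f.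
  by move=> [[k v] j] [[k' v'] j'] [] /ord_inj -> -> /ord_inj ->.
rewrite -(prob_marginal R _ f_inj); apply: eq_prob => u.
have agree_u : agree_below N (extend_coins u)
    (extend_coins ([ffun i => u (f i)] : {ffun 'I_N * 'I_n * 'I_N -> bool})).
  move=> k v j kN jN; rewrite (extend_coinsE _ (Ordinal kN) (Ordinal jN)) ffunE.
  exact: (extend_coinsE _ (widen_ord NN' (Ordinal kN)) (widen_ord NN' (Ordinal jN))).
by apply: asbool_equiv_eq; split; apply: EN => //; apply: agree_below_sym.
Qed.

Lemma Pr_determined E N :
  determined_below N E -> Pr R E = prob R (coin_event E N).
Proof.
move=> EN; rewrite -frequencyE; apply: (@lim_near_cst R) => //.
near=> N'; apply: frequency_determined => //.
by near: N'; exists N.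
Unshelve. all: by end_near.
Qed.

End Determined.

Arguments coin_event {n} E N w.

(** * Executions *)

Definition agree_up_to (Sigma : countType) (A : algorithm Sigma)
    (T : triplet Sigma) (K N : nat) : Prop :=
  forall w w' : coins (nodes T), agree_below N w w' ->
  forall k, (k <= K)%N -> forall v, @config Sigma A T w k v = @config Sigma A T w' k v.

(** The number of tosses in a round may depend on earlier coins. By induction the states before that
    round are functions of finitely many coins, so they take finitely many values and the number of
    tosses has a maximum. *)
Lemma config_finitely_many_coins (Sigma : countType) (A : algorithm Sigma)
  (T : triplet Sigma) (K : nat) : exists N, agree_up_to A T K N.
Proof.
elim: K => [|K [N IH]].
  exists (\max_v tosses (wake A (ident v) (tnth (input T) v))).+1 => w w' ww'.
  move=> k; rewrite leqn0 => /eqP -> v; rewrite /= /local_step.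
  congr (compute _ _); apply/eq_in_map => j; rewrite mem_iota => /andP[_ jlt].
  by apply: ww' => //; rewrite ltnS (leq_trans (ltnW jlt)) // leq_bigmax.
pose s (w : coins (nodes T)) v :=
  receive (@config Sigma A T w K v) (inbox (@config Sigma A T w K) v).
pose N1 := \max_(u : {ffun 'I_N * 'I_(nodes T) * 'I_N -> bool})
  \max_v tosses (s (extend_coins u) v).
have sN w w' : agree_below N w w' -> s w = s w'.
  move=> ww'; suff E : @config Sigma A T w K = @config Sigma A T w' K by rewrite /s E.
  by apply/funext => v; apply: IH.
have tosses_le w v : (tosses (s w v) <= N1)%N.
  pose u : {ffun 'I_N * 'I_(nodes T) * 'I_N -> bool} :=
    [ffun z : 'I_N * 'I_(nodes T) * 'I_N => w z.1.1 z.1.2 z.2].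
  have -> : s w = s (extend_coins u).
    apply: sN => k x j kN jN.
    by rewrite (extend_coinsE _ (Ordinal kN) (Ordinal jN)) ffunE.
  exact: leq_trans (leq_bigmax v) (leq_bigmax u).
(* [K.+2] places round [K.+1] strictly below the bound, and [N1] the coins tossed in it. *)
exists (N + N1 + K.+2)%N => w w' ww' k.
have wwN : agree_below N w w' by apply: agree_belowW ww'; lia.
rewrite leq_eqVlt ltnS => /predU1P[-> v|]; last exact: IH.
rewrite /= -/(s w v) -/(s w' v) (sN _ _ wwN) /local_step.
congr (compute _ _); apply/eq_in_map => j; rewrite mem_iota => /andP[_ jlt].
have jle := leq_trans jlt (tosses_le w' v); apply: ww'; lia.
Qed.

Lemma outputs_congr (Sigma : countType) (A : algorithm Sigma)
    (T T' : triplet Sigma) (w : coins (nodes T)) (w' : coins (nodes T'))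
    (v : 'I_(nodes T)) (v' : 'I_(nodes T')) (K : nat) (b : bool) :
  (forall k, terminates_at A T w v k b -> (k <= K)%N) ->
  (forall k, (k <= K)%N -> config A w k v = config A w' k v') ->
  outputs A T w v b -> outputs A T' w' v' b.
Proof.
move=> bnd E [k vk]; have kK := bnd _ vk; case: vk => outk prev.
exists k; split; first by rewrite -E.
by move=> j jk; rewrite -E ?prev // ltnW // (leq_trans jk).
Qed.

(** One of the two truncated subtractions is 0, so this is the absolute difference. When adjacent
    nodes are at [dist] at most 1, it bounds the graph distance from below, which is what locality
    requires. *)
Definition dist (u v : nat) : nat := (u - v + (v - u))%N.

Section Locality.
Variables (Sigma : countType) (A : algorithm Sigma) (G : graph).
Variables (id : 'I_(nodes G) -> int) (id_inj : injective id).
Hypothesis adj_dist : forall u v : 'I_(nodes G), adj u v -> (dist u v <= 1)%N.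

Definition network (x : (nodes G).-tuple Sigma) : triplet Sigma :=
  @Triplet Sigma (Instance x) id id_inj.

Definition same_view (K : nat) (x x' : (nodes G).-tuple Sigma)
    (w w' : coins (nodes G)) (v : 'I_(nodes G)) : Prop :=
  forall u : 'I_(nodes G), (dist v u <= K)%N ->
    tnth x u = tnth x' u /\ forall k j, w k u j = w' k u j.

(** One round of communication enlarges the view by one: the radius-k views of [v] and of its
    neighbors lie in the radius-(k+1) view of [v]. *)
Lemma config_local k x x' (w w' : coins (nodes G)) v :
  same_view k x x' w w' v ->
  @config Sigma A (network x) w k v = @config Sigma A (network x') w' k v.
Proof.
have step (j : nat) (u : 'I_(nodes G)) s : (forall i, w j u i = w' j u i) ->
    @local_step Sigma A (network x) w j u s =
    @local_step Sigma A (network x') w' j u s.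
  by move=> ww'; congr (compute _ _); apply/eq_in_map => i _; exact: ww'.
have dist0 (u : 'I_(nodes G)) : dist u u = 0%N by rewrite /dist subnn.
elim: k v => [|k IHk] v view.
  have [|xv wv] := view v; first by rewrite dist0.
  by rewrite /= xv; apply: step.
have [|_ wv] := view v; first by rewrite dist0.
have IH (u : 'I_(nodes G)) : (dist v u <= 1)%N ->
    @config Sigma A (network x) w k u = @config Sigma A (network x') w' k u.
  move=> vu; apply: IHk => u' uu'; apply: view.
  move: vu uu'; rewrite /dist; lia.
rewrite /= step //; congr (local_step _ _ _ (receive _ _)).
  by apply: IH; rewrite dist0.
apply/funext => i; rewrite /inbox /=; case: pickP => //= u /andP[vu _].
by rewrite IH // adj_dist.
Qed.

Lemma outputs_local K x x' (w w' : coins (nodes G)) v b :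
  (forall k, terminates_at A (network x) w v k b -> (k <= K)%N) ->
  same_view K x x' w w' v ->
  outputs A (network x) w v b -> outputs A (network x') w' v b.
Proof.
move=> bnd view; apply: (outputs_congr bnd) => k kK.
by apply: config_local => u vu; apply: view; apply: leq_trans kK.
Qed.

End Locality.

Lemma outputs_fun (Sigma : countType) (A : algorithm Sigma) (T : triplet Sigma)
    (w : coins (nodes T)) v b b' :
  outputs A T w v b -> outputs A T w v b' -> b = b'.
Proof.
move=> [k [outk prevk]] [k' [outk' prevk']].
case: (ltngtP k k') => [/prevk'|/prevk|kk']; rewrite ?outk ?outk' //.
by move: outk'; rewrite -kk' outk => -[].
Qed.

Section YesNo.
Variables (Sigma : countType) (A : algorithm Sigma) (T : triplet Sigma) (K : nat).
Hypothesis terminates : forall w v, exists b, outputs A T w v b.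
Hypothesis within : forall w v k b, terminates_at A T w v k b -> (k <= K)%N.

Lemma some_noE w : some_no A (T := T) w <-> ~ all_yes A (T := T) w.
Proof.
split=> [[v vno] yes|no]; first by have := outputs_fun vno (yes v).
apply: contrapT => none; apply: no => v.
by have [[//|vno]] := terminates w v; case: none; exists v.
Qed.

Lemma outputs_agree N w w' v b : agree_up_to A T K N -> agree_below N w w' ->
  outputs A T w v b -> outputs A T w' v b.
Proof.
move=> N_K ww'; apply: (outputs_congr (@within w v ^~ b)) => k kK.
exact: N_K.
Qed.

Lemma Pr_all_yes (R : realType) N : agree_up_to A T K N ->
  Pr R (all_yes A (T := T)) = prob R (coin_event (all_yes A (T := T)) N).
Proof.
move=> N_K; apply: Pr_determined => w w' ww' yes v.
exact: outputs_agree N_K ww' (yes v).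
Qed.

Lemma Pr_some_no (R : realType) :
  Pr R (some_no A (T := T)) = 1 - Pr R (all_yes A (T := T)).
Proof.
have [N N_K] := config_finitely_many_coins A T K.
rewrite (Pr_all_yes _ N_K) -(probC _ (card_coins_gt0 _)).
rewrite (@Pr_determined _ _ _ N); last first.
  move=> w w' ww' [v vno]; exists v.
  exact: outputs_agree N_K ww' vno.
by apply: eq_prob => u; rewrite /= -asbool_neg; apply: asbool_equiv_eq; apply: some_noE.
Qed.

End YesNo.

(** * Path graphs *)

Section Path.
Variable n : nat.

Definition path_adj : rel 'I_n.+1 :=
  fun u v => (u.+1 == v :> nat) || (v.+1 == u :> nat).

Lemma path_adj_sym : symmetric path_adj.
Proof. by move=> u v; rewrite /path_adj orbC. Qed.

Lemma path_adj_irr : irreflexive path_adj.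
Proof. by move=> u; rewrite /path_adj; lia. Qed.

Lemma path_adj_conn (u v : 'I_n.+1) : connect path_adj u v.
Proof.
have conn0 (x : 'I_n.+1) : connect path_adj ord0 x.
  case: x => i; elim: i => [|i IHi] ilt.
    by rewrite (_ : Ordinal ilt = ord0) //; apply: val_inj.
  apply: connect_trans (IHi (ltnW ilt)) (connect1 _).
  by rewrite /path_adj /= eqxx.
apply: connect_trans (conn0 v).
by rewrite (sym_connect_sym path_adj_sym).
Qed.

Definition path_graph : graph :=
  Graph (ltn0Sn n) path_adj_sym path_adj_irr path_adj_conn.

End Path.

(** * The problem *)

Section CountingMachine.
Variables (A c : nat).

(* The state records the number of inputs equal to [c] read so far, capped at
   [A.+1], and the length of the current run of 1s, capped at [c.+1]. *)
Definition counter (k l : nat) : 'I_A.+2 * 'I_c.+2 :=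
  (inord (minn k A.+1), inord (minn l c.+1)).

(** In effect a finite automaton: the head moves right and rewrites what it reads until the
    separator. The caps lose nothing, as the run length is only tested for equality with [c], and
    the count only compared with [A]. *)
Definition count_step (q : 'I_A.+2 * 'I_c.+2) (s : option (option bool + void)) :
    bool + 'I_A.+2 * 'I_c.+2 * option (option bool + void) * bool :=
  match s with
  | Some (inl (Some true)) => inr (counter q.1 q.2.+1, s, true)
  | Some (inl (Some false)) => inr (counter (q.1 + (q.2 == c :> nat)) 0, s, true)
  | _ => inl (q.1 <= A)%N
  end.

Definition count_machine : machine (option bool) :=
  @Machine _ _ void (counter 0 0) count_step.

Arguments counter (k l)%_nat_scope.

Let halts (q : 'I_A.+2 * 'I_c.+2) l s b :=
  exists k, @mrun _ count_machine k q l s = Some b.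

Let halts_right q q' x s d l b :
  count_step q x = inr (q', d, true) ->
  halts q' (d :: l) s b -> halts q l (x :: s) b.
Proof. by move=> qx [k kb]; exists k.+1; rewrite /= qx. Qed.

Let counter1 k l : (counter k l).1 = minn k A.+1 :> nat.
Proof. by rewrite inordK //; lia. Qed.

Let counter2 k l : (counter k l).2 = minn l c.+1 :> nat.
Proof. by rewrite inordK //; lia. Qed.

(** For the induction on [a], [j] is the part of the run already read. The left tape is arbitrary
    because the head never moves left. *)
Let halts_symbol k j (a : nat) l s b :
  (forall l', halts (counter (k + (j + a == c)%N) 0) l' s b) ->
  halts (counter k j) l
    ([seq Some (inl x) | x <- rcons (nseq a (Some true)) (Some false)] ++ s) b.
Proof.
elim: a j l => [|a IHa] j l hs /=.
  apply: halts_right (hs _); rewrite /count_step counter1 counter2 /counter.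
  by congr (inr (inord _, _, _, _)); lia.
apply: (@halts_right _ (counter k j.+1)).
  rewrite /count_step counter1 counter2 /counter.
  by congr (inr (inord _, inord _, _, _)); lia.
by apply: IHa => l'; rewrite addSnnS.
Qed.

Lemma count_machine_halts (ns : seq nat) (rest : seq (option bool)) :
  mhalts count_machine
    (flatten [seq rcons (nseq a (Some true)) (Some false) | a <- ns]
       ++ None :: rest)
    (count_mem c ns <= A)%N.
Proof.
(* Generalized to [k] occurrences already counted. *)
suff H k l : halts (counter k 0) l [seq Some (inl x) | x <- flatten
    [seq rcons (nseq a (Some true)) (Some false) | a <- ns] ++ None :: rest]
    (k + count_mem c ns <= A)%N by apply: H.
elim: ns k l => [|a ns IHns] k l /=.
  exists 1%N; transitivity (Some ((counter k 0).1 <= A)%N) => //.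
  by rewrite counter1; congr Some; lia.
rewrite -catA map_cat; apply: halts_symbol => l'.
by rewrite addnA; apply: IHns.
Qed.

End CountingMachine.

Section Problem.
Variables (Sigma : countType) (a : Sigma) (A B : nat).

Definition selected (X : instance Sigma) : nat := count_mem a (input X).

Lemma selectedE (X : instance Sigma) :
  selected X = #|[pred v | tnth (input X) v == a]|.
Proof.
rewrite /selected -{1}(map_tnth_enum (input X)) count_map.
by rewrite enumT -size_filter cardE.
Qed.

Lemma selected_iso (X Y : instance Sigma) :
  isomorphic X Y -> selected X = selected Y.
Proof.
case=> f [f_bij _ fin]; rewrite !selectedE -!sum1_card.
rewrite [RHS](reindex f) /=; last exact: onW_bij.
by apply: eq_bigl => v; rewrite !unfold_in /= fin.
Qed.

Definition at_most : set (instance Sigma) := [set X | (selected X <= A)%N].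

Definition few_or_many : set (seq Sigma) :=
  [set x | (count_mem a x <= A)%N || (B <= count_mem a x)%N].

Lemma at_most_decidable : decidable_language at_most.
Proof.
exists (count_machine A (pickle a)) => X; exists (selected X <= A)%N => //.
have -> : selected X = count_mem (pickle a) [seq pickle x | x <- input X].
  rewrite /selected count_map; apply: eq_count => x /=.
  by rewrite (inj_eq (pcan_inj pickleK)).
have -> : encode X = flatten [seq rcons (nseq m (Some true)) (Some false)
      | m <- [seq pickle x | x <- input X]] ++ None ::
    [seq Some (adj u v) | u <- enum 'I_(nodes X), v <- enum 'I_(nodes X)].
  by rewrite -map_comp.
exact: count_machine_halts.
Qed.

Lemma at_most_iso X Y : isomorphic X Y -> at_most X -> at_most Y.
Proof. by rewrite /at_most /= => /selected_iso ->. Qed.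

Lemma few_or_many_iso (X Y : instance Sigma) :
  isomorphic X Y -> few_or_many (input X) -> few_or_many (input Y).
Proof. by move=> /selected_iso E; rewrite /few_or_many /= -!/(selected _) E. Qed.

Definition gap_problem : problem Sigma :=
  Problem at_most_decidable at_most_iso few_or_many_iso.

End Problem.

(** * The zero-round decider *)

Section TossDecider.
Variables (R : realType) (Sigma : countType) (a : Sigma).

(** The state is the output itself; [None] is a selected node about to toss its coin. After the
    computation of round 0 every state is a [Some]. *)
Definition toss_algorithm : algorithm Sigma :=
  @Algorithm Sigma (option bool) unit
    (fun _ x => if x == a then None else Some true)
    (fun s => (s == None) : nat)
    (fun s bs => Some (odflt (head true bs) s))
    (fun=> tt) (fun s _ => s) id.

Lemma toss_output (T : triplet Sigma) (w : coins (nodes T)) v :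
  output (config toss_algorithm w 0 v) =
  Some ((tnth (input T) v == a) ==> w 0 v 0).
Proof. by rewrite /= /local_step /=; case: (tnth _ v == a). Qed.

Lemma toss_terminates (T : triplet Sigma) (w : coins (nodes T)) v k b :
  terminates_at toss_algorithm T w v k b <->
  k = 0%N /\ b = ((tnth (input T) v == a) ==> w 0 v 0).
Proof.
split=> [[outk prevk]|[-> ->]]; last by split; rewrite ?toss_output.
case: k outk prevk => [|k] outk prevk; last first.
  by have := prevk 0%N isT; rewrite toss_output.
by move: outk; rewrite toss_output => -[->].
Qed.

Lemma toss_outputs (T : triplet Sigma) (w : coins (nodes T)) v b :
  outputs toss_algorithm T w v b <-> b = ((tnth (input T) v == a) ==> w 0 v 0).
Proof.
split=> [[k /toss_terminates[]] //|vb].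
by exists 0%N; apply/toss_terminates.
Qed.

Lemma toss_all_yes (T : triplet Sigma) (w : coins (nodes T)) :
  all_yes toss_algorithm w <->
  all (fun v => w 0 v 0) (enum [pred v | tnth (input T) v == a]).
Proof.
split=> [yes|/allP yes v].
  apply/allP => v; rewrite mem_enum inE => va.
  by have /toss_outputs := yes v; rewrite va.
apply/toss_outputs; apply/esym/implyP => va; apply: yes.
by rewrite mem_enum inE.
Qed.

Lemma Pr_toss_all_yes (T : triplet Sigma) :
  Pr R (all_yes toss_algorithm (T := T)) = 2^-1 ^+ selected a T.
Proof.
rewrite (@Pr_determined _ _ _ 1); last first.
  move=> w w' ww' /toss_all_yes/allP yes; apply/toss_all_yes/allP => v vs.
  by rewrite -ww' //; apply: yes.
rewrite selectedE cardE.
have f_inj : injective (fun v : 'I_(nodes T) => (ord0, v, ord0) : 'I_1 * _ * 'I_1).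
  by move=> u v [].
rewrite -(prob_all_coins R f_inj (enum_uniq _)); apply: eq_prob => u.
rewrite -[RHS]asboolb; apply: asbool_equiv_eq; rewrite toss_all_yes.
by split; congr (is_true _); apply: eq_all => v; rewrite -extend_coinsE.
Qed.

Lemma gap_problem_zero_round (A B : nat) (r' : R) :
  (0 < B)%N -> A%:R * (1 + r'^-1) < B%:R ->
  class_C r' (fun=> 0) (gap_problem a A B).
Proof.
move=> B_gt0 ltAB; exists (2^-1 ^+ A), (1 - 2^-1 ^+ B).
have [half_gt0 half_le1] : (0 : R) < 2^-1 /\ (2^-1 : R) <= 1 by split; lra.
have half01 k : 0 < (2^-1 ^+ k : R) <= 1.
  by rewrite exprn_gt0 // exprn_ile1 // ltW.
have half_le k l : (k <= l)%N -> 2^-1 ^+ l <= 2^-1 ^+ k :> R.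
  by move=> kl; apply: ler_wiXn2l => //; apply: ltW.
(* Keeps [q] positive. *)
have halfB : 2^-1 ^+ B <= 2^-1 :> R by rewrite -[leRHS]expr1 half_le.
split.
- exact: half01.
- by have := half01 B; lra.
(* Both sides are powers of 2, so the claim compares exponents: [A * (1 + 1/r') < B]. *)
- suff : 2^-1 ^+ B < (2^-1 ^+ A) `^ (1 + r'^-1) :> R by lra.
  have half_powR k : 2^-1 ^+ k = 2 `^ (- k%:R) :> R.
    by rewrite powRN powR_mulrn // exprVn.
  rewrite !half_powR -powRrM /powR pnatr_eq0 /= ltr_expR ltr_pM2r ?ln_gt0; lra.
- exists toss_algorithm => [T adm|T _ w v k b /toss_terminates[-> _]] //.
  have term w v : exists b, outputs toss_algorithm T w v b.
    by eexists; apply/toss_outputs.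
  split=> // [few|many].
    by rewrite Pr_toss_all_yes half_le.
  rewrite (@Pr_some_no _ _ _ 0) //; last by move=> w v k b /toss_terminates[->].
  rewrite Pr_toss_all_yes lerB // half_le //.
  (* The promise turns more than [A] selected nodes into at least [B]. *)
  by move: adm => /orP[|//] few; case: many.
Qed.

End TossDecider.

(** * The lower bound *)

(* Multiply the hypothesis over the B cyclic intervals of length A: each index
   lies in exactly A of them. *)
Lemma prod_of_prod_subsets (R : realFieldType) (A B : nat) (y : 'I_B -> R) (p : R) :
  (A <= B)%N -> 0 <= p ->
  (forall c : {set 'I_B}, #|c| = A -> p <= \prod_(j in c) y j) ->
  p ^+ B <= (\prod_j y j) ^+ A.
Proof.
(* Addition modulo the size of the ordinal needs a successor; for size 0 both sides are 1. *)
case: B y => [|B] y leAB p_ge0 p_le.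
  by move: leAB; rewrite leqn0 => /eqP ->; rewrite !expr0.
pose interval (i : 'I_B.+1) := [set i + widen_ord leAB k | k : 'I_A]%SET.
have shift_inj i : injective (fun k : 'I_A => i + widen_ord leAB k).
  move=> k k' /addrI /(congr1 val) /= kk'; exact: val_inj.
have -> : p ^+ B.+1 = \prod_(i < B.+1) p by rewrite prodr_const card_ord.
apply: (@le_trans _ _ (\prod_(i < B.+1) \prod_(k < A) y (i + widen_ord leAB k))).
  apply: ler_prod => i _; rewrite p_ge0 /=.
  have := p_le (interval i); rewrite card_imset // card_ord => /(_ erefl).
  rewrite big_imset /=; last by move=> k k' _ _ /shift_inj.
  by under eq_bigl do rewrite inE.
rewrite exchange_big /=.
have -> : (\prod_j y j) ^+ A = \prod_(k < A) \prod_j y j.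
  by rewrite prodr_const card_ord.
rewrite le_eqVlt (_ : _ == _) //; apply/eqP; apply: eq_bigr => k _.
by rewrite [RHS](reindex_inj (addIr (widen_ord leAB k))).
Qed.

(** Otherwise the product would be at most [(1 - d) ^+ m]. The factors will be the probabilities
    that the candidate gaps say yes. *)
Lemma prod_factor_ge (R : realType) (m : nat) (x : 'I_m -> R) (d p : R) :
  d <= 1 -> (forall h, 0 <= x h) -> (1 - d) ^+ m < p -> p <= \prod_h x h ->
  exists h, 1 - d <= x h.
Proof.
move=> d_le1 x_ge0 small le_prod; apply: contrapT => none.
have : \prod_h x h <= \prod_(h < m) (1 - d).
  apply: ler_prod => h _; rewrite x_ge0 /= leNgt; apply/negP => lt_x.
  by apply: none; exists h; apply: ltW.
rewrite prodr_const card_ord => le_pow.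
by have := lt_le_trans small (le_trans le_prod le_pow); rewrite ltxx.
Qed.

(** * Geometry of marks, gaps and segments *)

Section Blocks.
Variables (m W K : nat).
Hypothesis K_lt : (K.*2 < W)%N.

Let M := m.*2.+4.

(* The path is cut into blocks of W nodes, and the blocks into B periods of M;
   the selected nodes are the first ones of the periods. The h-th candidate gap
   consists of one block in each period, never next to a selected node. *)
Definition mark (j : nat) : nat := (j * M * W)%N.

(** Block number, shifted so that gap [h] has residue [M - 1] and a segment starts at residue 0. Gap
    [h] thus sits at offset [2m + 1 - 2h] of its period: the gaps take the odd offsets from 3 to
    [2m + 1], so no two are adjacent. *)
Definition rank (h v : nat) : nat := (v %/ W + h.+1.*2)%N.

Definition in_gap (h v : nat) : bool := (rank h v %% M == M.-1)%N.

Let W_gt0 : (0 < W)%N. Proof. exact: leq_ltn_trans K_lt. Qed.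

(** Two nodes at distance less than the block width cannot have a whole block between them. *)
Let block_near u v : (dist u v <= K.*2)%N ->
  [\/ v %/ W = u %/ W, v %/ W = (u %/ W).+1 | u %/ W = (v %/ W).+1]%N.
Proof.
rewrite /dist => uv.
have := divn_eq u W; have := divn_eq v W.
have := ltn_pmod u W_gt0; have := ltn_pmod v W_gt0.
set qu := (u %/ W)%N; set qv := (v %/ W)%N.
move=> rv ru Ev Eu.
case: (ltngtP qu qv) => [lt|lt|eq]; last by constructor 1.
- constructor 2; case: (ltngtP qv qu.+1) => [|lt2|//]; first by lia.
  have : (qu.+2 * W <= qv * W)%N by rewrite leq_mul2r lt2 orbT.
  rewrite !mulSn; lia.
- constructor 3; case: (ltngtP qu qv.+1) => [|lt2|//]; first by lia.
  have : (qv.+2 * W <= qu * W)%N by rewrite leq_mul2r lt2 orbT.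
  rewrite !mulSn; lia.
Qed.

Lemma gap_far h j v : (h < m)%N -> in_gap h v -> (K < dist v (mark j))%N.
Proof.
move=> hm; apply: contraTltn => near.
have {}near : (dist (mark j) v <= K.*2)%N by move: near; rewrite /dist; lia.
(* The mark has rank [j * M + 2(h + 1)], and adjacent blocks differ from it by one; [2h + 3 < M - 1]
   since [h < m]. *)
have [r [rM rank_v]] : exists r, (r < M.-1 /\ rank h v = j * M + r)%N.
  rewrite /rank; move: (block_near near); rewrite {1 2 3}/mark mulnK //.
  by case=> [->|->|jM]; [exists h.+1.*2|exists h.+1.*2.+1|exists h.*2.+1];
    rewrite ?jM /M; lia.
rewrite /in_gap rank_v modnMDl modn_small ?neq_ltn ?rM //.
by apply: leq_trans rM _; rewrite leq_pred.
Qed.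

(** The two ranks are congruent modulo [M] and differ by less than [M], so they agree. Block numbers
    differing by at most 1 then leave no room for distinct even shifts. *)
Lemma gap_inj h h' v v' : (h < m)%N -> (h' < m)%N -> in_gap h v ->
  in_gap h' v' -> (dist v v' <= K.*2)%N -> h = h'.
Proof.
have mod_inj x y : (x %% M = y %% M -> x <= y -> y < x + M -> x = y)%N.
  move=> /eqP; rewrite eq_sym => mod_eq le_xy lt_yx.
  move: mod_eq; rewrite eqn_mod_dvd // => dvd_xy.
  have [|//] := posnP (y - x)%N; first by lia.
  by move=> /dvdn_leq /(_ dvd_xy); lia.
move=> hm hm' /eqP gh /eqP gh' /block_near near.
suff : rank h v = rank h' v' by rewrite /rank; case: near => ->; lia.
have mod_eq : (rank h v %% M = rank h' v' %% M)%N by rewrite gh gh'.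
have [le|/ltnW le] := leqP (rank h v) (rank h' v'); last symmetry;
  by apply: mod_inj => //; move: le; rewrite /rank /M; case: near => ->; lia.
Qed.

Lemma mark_inj : injective mark.
Proof.
by move=> i j /eqP; rewrite /mark !eqn_pmul2r // => /eqP.
Qed.

Variable B : nat.

Lemma mark_lt j : (j < B)%N -> (mark j < B * M * W)%N.
Proof. by move=> jB; rewrite /mark ltn_pmul2r // ltn_pmul2r. Qed.

(** [B] gaps cut the path into [B + 1] pieces; the remainder modulo [B] attaches the last piece,
    which has no mark, to segment 0. *)
Definition segment (h v : nat) : nat := (rank h v %/ M %% B)%N.

Let divn_succ (x : nat) : (x %% M != M.-1 -> x.+1 %/ M = x %/ M)%N.
Proof.
move=> xM; rewrite divnS //; have [|//] := boolP (M %| x.+1)%N.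
move=> /dvdnP[[|k] //= Ek].
case/eqP: xM; have -> : x = (k * M + M.-1)%N by move: Ek; rewrite mulSn /M; lia.
by rewrite modnMDl modn_small.
Qed.

(** Passing to the next block changes the quotient by [M] only from residue [M - 1], that is, from
    the gap. *)
Lemma segment_near h u v : (dist u v <= K.*2)%N -> ~~ in_gap h u ->
  ~~ in_gap h v -> segment h u = segment h v.
Proof.
rewrite /in_gap /segment /rank => /block_near[->//|->|->] gu gv.
  by rewrite addSn divn_succ.
by rewrite addSn divn_succ.
Qed.

Lemma segment_mark h j : (h < m)%N -> (j < B)%N -> segment h (mark j) = j.
Proof.
move=> hm jB; rewrite /segment /rank /mark mulnK // divnMDl // divn_small.
  by rewrite addn0 modn_small.
by rewrite /M; lia.
Qed.

End Blocks.

(** * Instances given by a set of selected marks *)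

Section MarkedInstances.
Variables (R : realType) (Sigma : countType) (a b : Sigma).
Variables (Alg : algorithm Sigma) (G : graph) (id : 'I_(nodes G) -> int).
Variables (id_inj : injective id).
Hypothesis adj_dist : forall u v : 'I_(nodes G), adj u v -> (dist u v <= 1)%N.
Variables (B : nat) (x : 'I_B -> 'I_(nodes G)).

Definition marked_input (c : {set 'I_B}) : (nodes G).-tuple Sigma :=
  [tuple if v \in [set x j | j in c]%SET then a else b | v < nodes G].

Definition marked (c : {set 'I_B}) : triplet Sigma :=
  network id_inj (marked_input c).

Lemma selected_marked c : a != b -> injective x -> selected a (marked c) = #|c|.
Proof.
move=> neq_ab x_inj.
rewrite selectedE -(card_imset c x_inj); apply: eq_card => v.
rewrite unfold_in /= tnth_mktuple; case: ifP => _; first by rewrite eqxx.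
by rewrite eq_sym (negPf neq_ab).
Qed.

Variables (K : nat) (good : pred {set 'I_B}).
Hypothesis within : forall c, good c ->
  forall w v k o, terminates_at Alg (marked c) w v k o -> (k <= K)%N.

Variable N : nat.
Hypothesis N_K : forall c, agree_up_to Alg (marked c) K N.

Local Notation Omega := {ffun 'I_N * 'I_(nodes G) * 'I_N -> bool}.

Definition yes (c : {set 'I_B}) (P : pred 'I_(nodes G)) : pred Omega :=
  fun u => [forall (v | P v), `[< outputs Alg (marked c) (extend_coins u) v true >]].

Lemma yesP c (P : pred 'I_(nodes G)) (u : Omega) :
  reflect (forall v, P v -> outputs Alg (marked c) (extend_coins u) v true)
          (yes c P u).
Proof.
apply: (iffP forall_inP) => H v Pv; first by apply/asboolP; apply: H.
by apply/asboolP; apply: H.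
Qed.

Lemma Pr_marked c : good c ->
  Pr R (all_yes Alg (T := marked c)) = prob R (yes c predT).
Proof.
move=> good_c; rewrite (Pr_all_yes (within good_c) R (@N_K c)).
apply: eq_prob => u; apply/asboolP/yesP => [H v _|H v]; exact: H.
Qed.

Lemma same_view_marked (c c' : {set 'I_B}) (w w' : coins (nodes G))
    (v : 'I_(nodes G)) :
  (forall j, (dist v (x j) <= K)%N -> (j \in c) = (j \in c')) ->
  (forall u : 'I_(nodes G), (dist v u <= K)%N -> forall k j, w k u j = w' k u j) ->
  same_view K (marked_input c) (marked_input c') w w' v.
Proof.
move=> cc' ww' u vu; split; last exact: ww'.
rewrite !tnth_mktuple; congr (if _ then _ else _).
by apply/imsetP/imsetP => -[j jc Eu]; exists j => //; move: jc;
  rewrite cc' // -Eu.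
Qed.

(** Nodes of [P] see the same selected marks in both instances. Both sets are [good] because running
    times are bounded under the promise only. *)
Lemma yes_congr (c c' : {set 'I_B}) (P : pred 'I_(nodes G)) : good c -> good c' ->
  (forall v j, P v -> (dist v (x j) <= K)%N -> (j \in c) = (j \in c')) ->
  yes c P =1 yes c' P.
Proof.
move=> good_c good_c' cc' u; apply/yesP/yesP => H v Pv.
  apply: (outputs_local adj_dist (@within _ good_c _ v ^~ true) _ (H v Pv)).
  by apply: same_view_marked => // j; apply: cc'.
apply: (outputs_local adj_dist (@within _ good_c' _ v ^~ true) _ (H v Pv)).
by apply: same_view_marked => // j vj; rewrite (cc' v).
Qed.

Definition coins_near (P : pred 'I_(nodes G)) : pred ('I_N * 'I_(nodes G) * 'I_N) :=
  fun z => [exists (v | P v), (dist v z.1.2 <= K)%N].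

Lemma yes_depends_on (c : {set 'I_B}) (P : pred 'I_(nodes G)) : good c ->
  depends_on (yes c P) (coins_near P).
Proof.
move=> good_c.
suff H (u u' : Omega) :
    {in coins_near P, u =1 u'} ->
    yes c P u -> yes c P u'.
  by move=> u u' uu'; apply/idP/idP; apply: H => // z zP; rewrite uu'.
move=> uu' /yesP H; apply/yesP => v Pv.
apply: (outputs_local adj_dist (@within _ good_c _ v ^~ true) _ (H v Pv)).
apply: same_view_marked => // y vy k j; rewrite /extend_coins.
case: insubP => // k' _ _; case: insubP => // j' _ _.
by apply: uu'; rewrite unfold_in; apply/exists_inP; exists v.
Qed.

(** Balls of radius [K] around nodes more than [2K] apart are disjoint, so the events read disjoint
    sets of coins. *)
Lemma yes_independent (I : eqType) (s : seq I) (c : {set 'I_B})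
    (P : I -> pred 'I_(nodes G)) :
  good c -> uniq s ->
  (forall i i' v v', P i v -> P i' v' -> (dist v v' <= K.*2)%N -> i = i') ->
  prob R (fun u => all (fun i => yes c (P i) u) s) = \prod_(i <- s) prob R (yes c (P i)).
Proof.
move=> good_c s_uniq far.
apply: (@prob_independent _ _ _ _ _ (fun i => coins_near (P i)) s_uniq).
  by move=> i; apply: yes_depends_on good_c.
move=> i i' z /exists_inP[v Pv vz] /exists_inP[v' Pv' vz'].
by apply: far Pv Pv' _; move: vz vz'; rewrite /dist; lia.
Qed.

(** Transfers bounds between selections of marks: a segment sees no mark but its own, and the gap
    sees none. *)
Lemma prod_segments_le (A : nat) (gap : pred 'I_(nodes G))
    (seg : 'I_(nodes G) -> 'I_B) (p d : R) :
  (A <= B)%N -> 0 <= p ->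
  (forall c : {set 'I_B}, #|c| = A -> good c) -> good finset.set0 ->
  good [set: 'I_B]%SET ->
  (forall c : {set 'I_B}, #|c| = A -> p <= Pr R (all_yes Alg (T := marked c))) ->
  (forall u v, ~~ gap u -> ~~ gap v -> (dist u v <= K.*2)%N -> seg u = seg v) ->
  (forall j, seg (x j) = j) -> (forall j, ~~ gap (x j)) ->
  (forall v j, gap v -> (K < dist v (x j))%N) ->
  1 - d <= prob R (yes finset.set0 gap) ->
  exists y : R, [/\ 0 <= y, p ^+ B <= y ^+ A &
    y <= Pr R (all_yes Alg (T := marked [set: 'I_B]%SET)) + d].
Proof.
move=> leAB p_ge0 goodA good0 goodT le_p seg_near seg_x gap_x gap_far le_gap.
pose part (j : 'I_B) : pred 'I_(nodes G) := fun v => ~~ gap v && (seg v == j).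
have part_far i i' v v' : part i v -> part i' v' -> (dist v v' <= K.*2)%N -> i = i'.
  by move=> /andP[gv /eqP <-] /andP[gv' /eqP <-]; apply: seg_near.
exists (\prod_j prob R (yes [set: 'I_B]%SET (part j))).
split; first by apply: prodr_ge0 => j _; apply: prob_ge0.
  apply: prod_of_prod_subsets => // c cA.
  apply: le_trans (le_p c cA) _; rewrite (Pr_marked (goodA c cA)).
  rewrite -big_enum -(yes_independent goodT (enum_uniq _) part_far).
  apply: prob_le => u /yesP H; apply/allP => j; rewrite mem_enum => jc.
  rewrite -(yes_congr (goodA c cA) goodT); first by apply/yesP => v _; apply: H.
  (* A mark seen from segment [j] is mark [j] itself, which is selected in [c] as well as in the
     full set. *)
  move=> v i /andP[gv /eqP vj] vi; rewrite inE; move: jc.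
  by rewrite -vj (seg_near _ (x i)) ?seg_x //; lia.
rewrite -big_enum -(yes_independent goodT (enum_uniq _) part_far).
(* Everybody says yes once all segments and the gap do; the gap fails with probability at most
   [d]. *)
apply: le_trans (prob_le_predI _ (card_coins_gt0 _) _ (yes [set: 'I_B]%SET gap)) _.
rewrite (Pr_marked goodT) lerD //.
  apply: prob_le => u /andP[/allP Hpart /yesP Hgap]; apply/yesP => v _.
  have [/Hgap //|gv] := boolP (gap v).
  have /yesP := Hpart (seg v) (mem_enum _ _).
  by apply; rewrite /part gv eqxx.
rewrite lerBlDr addrC -lerBlDr.
rewrite (eq_prob _ (@yes_congr [set: 'I_B]%SET finset.set0 gap _ _ _)) //.
by move=> v j gv; rewrite leqNgt gap_far.
Qed.

End MarkedInstances.

Lemma agree_up_toW (Sigma : countType) (Alg : algorithm Sigma)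
    (T : triplet Sigma) (K N N' : nat) :
  (N <= N')%N -> agree_up_to Alg T K N -> agree_up_to Alg T K N'.
Proof. by move=> NN' N_K w w' ww'; apply: N_K; apply: agree_belowW ww'. Qed.

Lemma path_adj_dist n (u v : 'I_(nodes (path_graph n))) :
  adj u v -> (dist u v <= 1)%N.
Proof. by rewrite /adj /= /path_adj /dist; lia. Qed.

Lemma exprn_small (R : realType) (x p : R) : 0 <= x -> x < 1 -> 0 < p ->
  exists m, x ^+ m < p.
Proof.
move=> x_ge0 x_lt1 p_gt0.
have /cvgr_lt /(_ _ p_gt0) [m _ /(_ m (leqnn _)) /=] : x ^+ n @[n --> \oo] --> 0.
  by apply: cvg_expr; rewrite ger0_norm.
by exists m.
Qed.

(** * Choice of parameters and contradiction *)

Section LowerBound.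
Variables (R : realType) (Sigma : countType) (a b : Sigma).
Hypothesis neq_ab : a != b.
Variables (A B : nat) (r : R) (t : triplet Sigma -> R).
Hypotheses (A_gt0 : (0 < A)%N) (lt_AB : (A < B)%N).
Hypothesis le_BA : B%:R <= A%:R * (1 + r^-1).
Hypothesis t_o_n : little_o_nodes t.

Lemma gap_problem_not_local : ~ class_C r t (gap_problem a A B).
Proof.
move=> [p [q [/andP[p_gt0 p_le1] /andP[q_gt0 q_le1] pq [Alg dec run]]]].
have B_gt0 : (0 < B)%N by apply: leq_trans lt_AB.
set e := 1 + r^-1 in pq; have le_BAe : B%:R <= A%:R * e := le_BA.
have pe_le1 : p `^ e <= 1.
  (* The sign of [e] is read off [0 < B <= A * e]. *)
  have e_ge0 : 0 <= e.
    have : 0 < A%:R * e by apply: lt_le_trans le_BAe; rewrite ltr0n.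
    by rewrite pmulr_rgt0 ?ltr0n // => /ltW.
  by rewrite -(powRr0 p) ger_powR // p_gt0.
(* Half of the slack: then [1 - q + d] is still below the power of [p]. *)
pose d := (p `^ e + q - 1) / 2.
have d_gt0 : 0 < d by rewrite /d; lra.
have d_le1 : d <= 1 by rewrite /d; lra.
have [m small] : exists m, (1 - d) ^+ m < p by apply: exprn_small; lra.
pose M := m.*2.+4.
have BM_gt0 : 0 < (B * M)%:R :> R by rewrite ltr0n muln_gt0 B_gt0.
have [n0 _ t_small] : \forall n \near \oo, forall T : triplet Sigma,
    nodes T = n -> `|t T / n%:R| <= (4 * (B * M)%:R)^-1.
  by apply: t_o_n; rewrite invr_gt0 mulr_gt0.
(* With [B * M * W] nodes, [t] is at most [W / 4], which bounds the number of rounds by [K]. [B * M]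
   is fixed before [W], and [W > n0] makes the path long enough for [t_small]. *)
pose W := n0.+1; pose K := (W %/ 4)%N.
have K_lt : (K.*2 < W)%N by rewrite /K /W; clear; lia.
pose n := (B * M * W).-1.
have n1 : n.+1 = (B * M * W)%N by rewrite prednK // !muln_gt0 B_gt0.
pose id (v : 'I_(nodes (path_graph n))) : int := (v : nat)%:Z.
have id_inj : injective id by move=> u v [] /val_inj.
have mark_n (j : 'I_B) : (mark m W j < n.+1)%N by rewrite n1 (mark_lt m K_lt).
pose x (j : 'I_B) : 'I_(nodes (path_graph n)) := Ordinal (mark_n j).
have x_inj : injective x.
  by move=> i j [] /(mark_inj K_lt) /val_inj.
pose inst c := marked a b id_inj x c.
have selected_inst c : selected a (inst c) = #|c|.
  exact: selected_marked.
pose good (c : {set 'I_B}) := (#|c| <= A)%N || (B <= #|c|)%N.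
have good_adm c : good c -> admissible (gap_problem a A B) (inst c).
  by rewrite /good -selected_inst.
have terminates c : good c -> forall w v, exists o, outputs Alg (inst c) w v o.
  by move=> /good_adm /dec [].
have within c : good c -> forall w v k o,
    terminates_at Alg (inst c) w v k o -> (k <= K)%N.
  move=> /good_adm adm w v k o /(run _ adm) le_kt.
  have := t_small n.+1 _ (inst c) erefl; rewrite /= n1.
  have -> : (n0 <= B * M * W)%N.
    by rewrite (leq_trans (leqnSn n0)) // leq_pmull // muln_gt0 B_gt0.
  move=> /(_ isT) /(le_trans (ler_norm _)).
  rewrite ler_pdivrMr; last by rewrite ltr0n -n1.
  rewrite (natrM _ (B * M)%N) invfM -mulrA mulKf ?gt_eqF // => le_tW.
  have : (k * 4)%:R <= W%:R :> R by rewrite natrM; lra.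
  by rewrite ler_nat leq_divRL.
have [f f_K] := fin_all_exists (fun c => config_finitely_many_coins Alg (inst c) K).
(* One bound on the coins for all the finitely many selections. *)
pose N := \max_c f c.
have N_K c : agree_up_to Alg (inst c) K N.
  by apply: agree_up_toW (f_K c); apply: leq_bigmax.
have few_good (c : {set 'I_B}) : (#|c| <= A)%N -> good c by rewrite /good => ->.
have few_p (c : {set 'I_B}) : (#|c| <= A)%N -> p <= Pr R (all_yes Alg (T := inst c)).
  move=> cA; have [_ + _] := dec _ (good_adm _ (few_good _ cA)).
  by apply; rewrite /= /at_most /= selected_inst.
have good0 : good finset.set0 by rewrite few_good // cards0.
have goodT : good [set: 'I_B]%SET by rewrite /good cardsT card_ord leqnn orbT.
pose gap h : pred 'I_(nodes (path_graph n)) := in_gap m W h.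
have [h le_gap] : exists h : 'I_m,
    1 - d <= prob R (yes a b Alg id_inj x (N := N) finset.set0 (gap h)).
  apply: (prod_factor_ge d_le1 _ small) => [h|]; first exact: prob_ge0.
  have := few_p finset.set0; rewrite cards0 => /(_ isT) /le_trans; apply.
  rewrite (Pr_marked _ within N_K good0) -big_enum /=.
  rewrite -(yes_independent R (@path_adj_dist n) within N good0 (enum_uniq _)).
    apply: prob_le => u /yesP H; apply/allP => i _.
    by apply/yesP => v _; apply: H.
  by move=> i i' v v' gi gi' vv'; apply/val_inj/(gap_inj K_lt _ _ gi gi' vv').
pose seg (v : 'I_(nodes (path_graph n))) : 'I_B :=
  Ordinal (ltn_pmod (rank W h v %/ m.*2.+4) B_gt0).
have [y [y_ge0 le_py le_y]] : exists y : R, [/\ 0 <= y, p ^+ B <= y ^+ A &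
    y <= Pr R (all_yes Alg (T := inst [set: 'I_B]%SET)) + d].
  apply: (prod_segments_le (@path_adj_dist n) within N_K
    (gap := gap h) (seg := seg)) => //.
  - exact: ltnW.
  - exact: ltW.
  - by move=> c cA; rewrite few_good ?cA.
  - by move=> c cA; rewrite few_p ?cA.
  - move=> u v gu gv uv; apply: val_inj; exact: (segment_near K_lt B uv gu gv).
  - move=> j; apply: val_inj; exact: (segment_mark K_lt).
  - move=> j; apply/negP => /(gap_far K_lt j (ltn_ord h)).
    by rewrite /dist subnn.
  - by move=> v j; apply: (gap_far K_lt j (ltn_ord h)).
(* All [B > A] marks selected: a no-instance that satisfies the promise. *)
have [_ _ /(_ _)] := dec _ (good_adm _ goodT).
rewrite /= /at_most /= selected_inst cardsT card_ord leqNgt lt_AB.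
rewrite (Pr_some_no (terminates _ goodT) (within _ goodT)) => /(_ (fun F => notF F)) le_q.
have lt_y : y < p `^ e by move: le_y le_q; rewrite /d; lra.
suff : y ^+ A < p ^+ B by rewrite ltNge le_py.
(* [A * e >= B] and [p <= 1], so [p] to the power [A * e] is at most [p ^+ B]. *)
apply: lt_le_trans (_ : (p `^ e) ^+ A <= _).
  by rewrite ltrXn2r // -lt0n.
rewrite -powR_mulrn ?powR_ge0 // -powRrM -powR_mulrn ?(ltW p_gt0) //.
by rewrite ger_powR ?p_gt0 // mulrC.
Qed.

End LowerBound.

(** Once [A > 1 / (i - i')], the interval from [A * (1 + i')] to [A * (1 + i)] is longer than 1, so
    the integer part of its right end lies inside. *)
Lemma rational_between (R : realType) (i i' : R) : 0 <= i' -> i' < i ->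
  exists A B : nat, [/\ (0 < A)%N, A%:R * (1 + i') < B%:R & B%:R <= A%:R * (1 + i)].
Proof.
move=> i'_ge0 lt_i.
pose A := (Num.truncn (i - i')^-1).+1.
have A_gt : 1 < A%:R * (i - i').
  by rewrite -ltr_pdivrMr ?subr_gt0 // mul1r truncnS_gt.
exists A, (Num.truncn (A%:R * (1 + i))).
have Ai_ge0 : 0 <= A%:R * (1 + i) by apply: mulr_ge0 => //; lra.
have /andP[leB ltB] := truncn_itv Ai_ge0.
split=> //; move: ltB A_gt; rewrite -natr1 !mulrDr mulrN mulr1; lra.
Qed.

Unset Implicit Arguments.

Theorem theorem5p1 (R : realType) (Sigma : countType) (a b : Sigma)
  (neq_ab : a != b) (r r' : R) (r_gt0 : 0 < r) (lt_rr' : r < r')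
  (t : triplet Sigma -> R) (t_o_n : little_o_nodes t) :
  class_C r' (fun=> 0) `\` class_C r t !=set0.
Proof.
have r'_gt0 := lt_trans r_gt0 lt_rr'.
have lt_inv : r'^-1 < r^-1 by rewrite ltf_pV2.
have r'V_ge0 : 0 <= r'^-1 by rewrite invr_ge0 ltW.
have [A [B [A_gt0 ltAB leBA]]] := rational_between r'V_ge0 lt_inv.
have lt_AB : (A < B)%N.
  rewrite -(ltr_nat R) (le_lt_trans _ ltAB) // ler_peMr //; lra.
exists (gap_problem a A B); split.
  by apply: gap_problem_zero_round ltAB; apply: leq_trans lt_AB.
exact: (gap_problem_not_local neq_ab A_gt0 lt_AB leBA t_o_n).
Qed.
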